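(* Let $M_1,M_2$ be smooth manifolds with $m_2=\dim M_2\ge 2$, and let $$\bar g(x,y,t)=g_1(x,t)\oplus\lambda^2(x,t)g_2(y,t),\qquad t\in[0,\bar T),$$ be a solution to the hyperbolic geometric flow $\frac{\partial^2}{\partial t^2}\bar g=-2\,\overline{\mathrm{Ric}}$ on the manifold $M_1\times M_2$, where $g_2$ is a fixed Einstein metric with constant $c$. Then the metric $g_1$ and the warping function $\lambda$ satisfy the evolution equations $$\frac{\partial^2}{\partial t^2}(g_1)_{ij}=-2\,{}^{M_1}\mathrm{Ric}_{ij}+\frac{2m_2}{\lambda}\mathrm{Hess}(\lambda)(\partial_i,\partial_j),$$ $$\frac{\partial^2}{\partial t^2}\lambda^2=-2c+\Delta_{M_1}\lambda^2+(2m_2-4)|\mathrm{grad}\,\lambda|^2.$$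
   Context: Here $g_1(\cdot,t)$ is a family of Riemannian metrics on $M_1$, $\lambda(x,t)>0$ is a smooth function of $x\in M_1$ and $t$, and $\bar g(t)=\pi_1^*g_1(t)+(\lambda(\cdot,t)\circ\pi_1)^2\pi_2^*g_2$, where $\pi_i$ are the projections; $\overline{\mathrm{Ric}}$ is the Ricci tensor of $\bar g(t)$. ''Fixed Einstein metric with constant $c$'' means $g_2$ does not depend on $t$ and ${}^{M_2}\mathrm{Ric}=c\,g_2$ for a constant $c$. Indices $i,j$ refer to local coordinates $x^i$ on $M_1$ ($\partial_i=\partial/\partial x^i$). ${}^{M_1}\mathrm{Ric}$ is the Ricci tensor of $g_1(t)$. $\mathrm{Hess}$, $\mathrm{grad}$, $|\cdot|$ and $\Delta_{M_1}=\mathrm{Tr}_{g_1}\mathrm{Hess}$ are taken on $(M_1,g_1(t))$. *)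

(* Defs.v *)
From HB Require Import structures.
From mathcomp Require Import all_boot all_order all_algebra.
From mathcomp Require Import all_classical all_reals all_analysis.

Set Implicit Arguments.
Unset Strict Implicit.
Unset Printing Implicit Defensive.

Import Order.TTheory GRing.Theory Num.Theory.
Import numFieldNormedType.Exports.

Local Open Scope classical_set_scope.
Local Open Scope ring_scope.

Definition pderive (R : realType) (n : nat) (i : 'I_n) (f : 'rV[R]_n -> R) :
  'rV[R]_n -> R := fun u => 'D_(delta_mx 0 i) f u.

Fixpoint Ck_on (R : realType) (n : nat) (D : set 'rV[R]_n) (k : nat)
    (f : 'rV[R]_n -> R) : Prop :=
  {in D, continuous f} /\
  (if k is k'.+1 then forall i : 'I_n,
     (forall u, D u -> derivable f u (delta_mx 0 i)) /\
     Ck_on D k' (pderive i f)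
   else True).

(* Meant for open [D]. *)
Definition smooth_on (R : realType) (n : nat) (D : set 'rV[R]_n)
    (f : 'rV[R]_n -> R) : Prop := forall k, Ck_on D k f.

(* The interval [0, T[, where [T] may be infinite. *)
Definition time_interval (R : realType) (T : \bar R) : set R :=
  [set t | 0 <= t /\ (t%:E < T)%E].

(* Time derivatives are relative to [0, T[, hence one-sided at t = 0. *)
Definition tquotient (R : realType) (f : R -> R) (t s : R) : R :=
  (f s - f t) / (s - t).

Definition tderivable (R : realType) (T : \bar R) (f : R -> R) (t : R) : Prop :=
  cvg (tquotient f t s @[s --> within (time_interval T) t^']).

Definition tderive (R : realType) (T : \bar R) (f : R -> R) : R -> R :=
  fun t => lim (tquotient f t s @[s --> within (time_interval T) t^']).

Definition tderive2 (R : realType) (T : \bar R) (f : R -> R) : R -> R :=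
  tderive T (tderive T f).

(* [f t u] is jointly C^k in (t, u) on [0, T[ * D: all its mixed partial
   derivatives up to order k exist and are jointly continuous. *)
Fixpoint Ck_family_on (R : realType) (n : nat) (T : \bar R) (D : set 'rV[R]_n)
    (k : nat) (f : R -> 'rV[R]_n -> R) : Prop :=
  {within time_interval T `*` D,
     continuous (fun z : R * 'rV[R]_n => f z.1 z.2)} /\
  (if k is k'.+1 then
     ((forall t u, time_interval T t -> D u -> tderivable T (f ^~ u) t) /\
      Ck_family_on T D k' (fun t u => tderive T (f ^~ u) t)) /\
     (forall i : 'I_n,
        (forall t u, time_interval T t -> D u ->
           derivable (f t) u (delta_mx 0 i)) /\
        Ck_family_on T D k' (fun t => pderive i (f t)))
   else True).

Definition smooth_family_on (R : realType) (n : nat) (T : \bar R)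
    (D : set 'rV[R]_n) (f : R -> 'rV[R]_n -> R) : Prop :=
  forall k, Ck_family_on T D k f.

(* A smooth structure is given by a smooth atlas, indexed by [chart] and not
   required to be maximal. [param c] is the inverse of the chart map [coord c],
   with junk values outside [coord c @` dom c]. Manifolds are nonempty: an
   equation on a product would say nothing if one factor could be empty. *)
Structure smoothManifold (R : realType) (n : nat) := SmoothManifold {
  carrier :> topologicalType ;
  chart : Type ;
  dom : chart -> set carrier ;
  coord : chart -> carrier -> 'rV[R]_n ;
  param : chart -> 'rV[R]_n -> carrier ;
  manifold_nonempty : [set: carrier] !=set0 ;
  manifold_hausdorff : hausdorff_space carrier ;
  manifold_second_countable : @second_countable carrier ;
  dom_open : forall c, open (dom c) ;
  dom_cover : forall p, exists c, dom c p ;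
  codom_open : forall c, open (coord c @` dom c) ;
  coordK : forall c, {in dom c, cancel (coord c) (param c)} ;
  coord_continuous : forall c, {in dom c, continuous (coord c)} ;
  param_continuous : forall c, {in coord c @` dom c, continuous (param c)} ;
  transition_smooth : forall c c' (k : 'I_n),
    smooth_on (coord c @` (dom c `&` dom c'))
      (fun u => coord c' (param c u) 0 k)
}.

Arguments chart {R n} s.
Arguments dom {R n s}.
Arguments coord {R n s}.
Arguments param {R n s}.

Section product.
Context {R : realType}.

Lemma Ck_on_cst n (D : set 'rV[R]_n) k (a : R) : Ck_on D k (fun=> a).
Proof.
elim: k a => [|k IH] a /=; split=> //; try by move=> u _; exact: cst_continuous.
move=> i; split; first by move=> u _; exact: derivable_cst.
rewrite (_ : pderive i _ = fun=> 0) //.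
by apply/funext => u; rewrite /pderive derive_cst.
Qed.

Lemma Ck_on_sub n (D E : set 'rV[R]_n) k f : E `<=` D -> Ck_on D k f -> Ck_on E k f.
Proof.
move=> ED; elim: k f => [|k IH] f /= [cf df]; split=> //.
- by move=> u; rewrite inE => /ED Du; apply: cf; rewrite inE.
- by move=> u; rewrite inE => /ED Du; apply: cf; rewrite inE.
move=> i; have [dfi Cf] := df i; split; last exact: IH.
by move=> u /ED /dfi.
Qed.

Lemma lsubmx_delta_l n1 n2 (i : 'I_n1) :
  lsubmx (delta_mx 0 (lshift n2 i) : 'rV[R]_(n1 + n2)) = delta_mx 0 i.
Proof. by apply/rowP => j; rewrite !mxE (inj_eq (@lshift_inj _ _)). Qed.

Lemma lsubmx_delta_r n1 n2 (i : 'I_n2) :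
  lsubmx (delta_mx 0 (rshift n1 i) : 'rV[R]_(n1 + n2)) = 0.
Proof. by apply/rowP => j; rewrite !mxE eq_lrshift andbF. Qed.

Lemma rsubmx_delta_r n1 n2 (i : 'I_n2) :
  rsubmx (delta_mx 0 (rshift n1 i) : 'rV[R]_(n1 + n2)) = delta_mx 0 i.
Proof. by apply/rowP => j; rewrite !mxE (inj_eq (@rshift_inj _ _)). Qed.

Lemma rsubmx_delta_l n1 n2 (i : 'I_n1) :
  rsubmx (delta_mx 0 (lshift n2 i) : 'rV[R]_(n1 + n2)) = 0.
Proof. by apply/rowP => j; rewrite !mxE eq_rlshift andbF. Qed.

Section linear_precomposition.
Context {n m : nat} (L : {linear 'rV[R]_n -> 'rV[R]_m}).

Let quotE (f : 'rV[R]_m -> R) u v :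
  (fun h : R => h^-1 *: ((f \o L \o shift u) (h *: v) - (f \o L) u)) =
  (fun h : R => h^-1 *: ((f \o shift (L u)) (h *: L v) - f (L u))).
Proof. by apply/funext => h /=; rewrite linearP. Qed.

Lemma derivable_comp_linear (f : 'rV[R]_m -> R) u v :
  derivable f (L u) (L v) -> derivable (f \o L) u v.
Proof. by rewrite /derivable quotE. Qed.

Lemma derive_comp_linear (f : 'rV[R]_m -> R) u v :
  'D_v (f \o L) u = 'D_(L v) f (L u).
Proof. by rewrite /derive quotE. Qed.

Lemma Ck_on_comp_linear (D : set 'rV[R]_m) k f : continuous L ->
  (forall i, L (delta_mx 0 i) = 0 \/ exists j, L (delta_mx 0 i) = delta_mx 0 j) ->
  Ck_on D k f -> Ck_on (L @^-1` D) k (f \o L).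
Proof.
move=> cL eL; elim: k f => [|k IH] f /= [cf df].
  split=> // u; rewrite inE /= => Du; apply: continuous_comp; first exact: cL.
  by apply: cf; rewrite inE.
split.
  move=> u; rewrite inE /= => Du; apply: continuous_comp; first exact: cL.
  by apply: cf; rewrite inE.
move=> i; case: (eL i) => [Li|[j Lj]]; split.
- move=> u Du; apply: derivable_comp_linear; rewrite Li; exact: derivable0.
- rewrite (_ : pderive i _ = fun=> 0); first exact: Ck_on_cst.
  by apply/funext => u; rewrite /pderive derive_comp_linear Li derive0.
- move=> u Du; apply: derivable_comp_linear; rewrite Lj; exact: (df j).1.
- rewrite (_ : pderive i _ = pderive j f \o L); last first.
    by apply/funext => u; rewrite /pderive derive_comp_linear Lj.
  exact/IH/(df j).2.
Qed.

End linear_precomposition.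
Context {n1 n2 : nat} (M1 : smoothManifold R n1) (M2 : smoothManifold R n2).
Implicit Types c : (chart M1 * chart M2)%type.

Definition prod_dom c : set (M1 * M2) := dom c.1 `*` dom c.2.

Definition prod_coord c (p : M1 * M2) : 'rV[R]_(n1 + n2) :=
  row_mx (coord c.1 p.1) (coord c.2 p.2).

Definition prod_param c (u : 'rV[R]_(n1 + n2)) : M1 * M2 :=
  (param c.1 (lsubmx u), param c.2 (rsubmx u)).

Lemma prod_nonempty : [set: M1 * M2] !=set0.
Proof.
have [x _] := manifold_nonempty M1; have [y _] := manifold_nonempty M2.
by exists (x, y).
Qed.

Lemma prod_hausdorff : hausdorff_space (M1 * M2)%type.
Proof.
move=> [x y] [x' y'] pq; congr pair.
  apply: manifold_hausdorff => A B xA xB.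
  have [||[z w] [[/= Az _] [/= Bz _]]] := pq (A `*` setT) (B `*` setT).
  - by exists (A, setT) => //; split=> //; exact: filterT.
  - by exists (B, setT) => //; split=> //; exact: filterT.
  - by exists z.
apply: manifold_hausdorff => A B xA xB.
have [||[z w] [[/= _ Az] [/= _ Bz]]] := pq (setT `*` A) (setT `*` B).
- by exists (setT, A) => //; split=> //; exact: filterT.
- by exists (setT, B) => //; split=> //; exact: filterT.
- by exists w.
Qed.

Lemma open_prod (T U : topologicalType) (A : set T) (B : set U) :
  open A -> open B -> open (A `*` B).
Proof.
rewrite !openE => oA oB [x y] [/= /oA Ax /oB By].
by exists (A, B).
Qed.

Lemma prod_second_countable : @second_countable (M1 * M2)%type.
Proof.
have [B1 cB1 [oB1 bB1]] := manifold_second_countable M1.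
have [B2 cB2 [oB2 bB2]] := manifold_second_countable M2.
exists ((fun AB => AB.1 `*` AB.2) @` (B1 `*` B2)).
  exact: sub_countable (card_image_le _ _) (countableX _ _).
split; first by move=> _ [[A B] [/= /oB1 oA /oB2 oB] <-]; exact: open_prod.
move=> [x y] W [[A B] [/= /bB1 [A' [A'1 A'x] A'A] /bB2 [B' [B'2 B'y] B'B]] ABW].
exists (A' `*` B'); last first.
  by move=> [z w] [/= zA' wB']; apply: ABW; split; [exact: A'A | exact: B'B].
by split=> //; exists (A', B').
Qed.

Lemma prod_dom_open c : open (prod_dom c).
Proof. by apply: open_prod; exact: dom_open. Qed.

Lemma prod_dom_cover p : exists c, prod_dom c p.
Proof.
have [c1 ?] := dom_cover p.1; have [c2 ?] := dom_cover p.2.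
by exists (c1, c2).
Qed.

Lemma prod_codomE c : prod_coord c @` prod_dom c =
  (lsubmx @^-1` (coord c.1 @` dom c.1)) `&` (rsubmx @^-1` (coord c.2 @` dom c.2)).
Proof.
apply/seteqP; split=> [_ [p [p1 p2] <-]|u [[x x1 ux] [y y2 uy]]].
  by rewrite /prod_coord; split=> /=; rewrite ?row_mxKl ?row_mxKr;
    [exists p.1 | exists p.2].
by exists (x, y) => //; rewrite /prod_coord /= ux uy hsubmxK.
Qed.

Lemma prod_codom_open c : open (prod_coord c @` prod_dom c).
Proof.
rewrite prod_codomE; apply: openI; apply: open_comp; try exact: codom_open.
- by move=> u _; exact: continuous_lsubmx.
- by move=> u _; exact: continuous_rsubmx.
Qed.

Lemma prod_coordK c : {in prod_dom c, cancel (prod_coord c) (prod_param c)}.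
Proof.
move=> [x y]; rewrite inE => -[/= cx cy].
by rewrite /prod_param /prod_coord row_mxKl row_mxKr /= !coordK ?inE.
Qed.

Lemma prod_coord_continuous c : {in prod_dom c, continuous (prod_coord c)}.
Proof.
move=> [x y]; rewrite inE => -[/= cx cy] W [P HP PW].
have C1 : {for x, continuous (coord c.1)} by apply: coord_continuous; rewrite inE.
have C2 : {for y, continuous (coord c.2)} by apply: coord_continuous; rewrite inE.
pose V1 := [set v : 'rV[R]_n1 | forall i j, P i (lshift n2 j) (v i j)].
pose V2 := [set v : 'rV[R]_n2 | forall i j, P i (rshift n1 j) (v i j)].
have nV1 : nbhs (coord c.1 x) V1.
  exists (fun i j => P i (lshift n2 j)) => // i j.
  by have := HP i (lshift n2 j); rewrite /prod_coord row_mxEl.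
have nV2 : nbhs (coord c.2 y) V2.
  exists (fun i j => P i (rshift n1 j)) => // i j.
  by have := HP i (rshift n1 j); rewrite /prod_coord row_mxEr.
exists (coord c.1 @^-1` V1, coord c.2 @^-1` V2).
  by split; [exact: C1 | exact: C2].
move=> [z w] [/= zV wV]; apply: PW => i j; rewrite /prod_coord.
by case: (split_ordP j) => k ->; rewrite ?row_mxEl ?row_mxEr.
Qed.

Lemma prod_param_continuous c :
  {in prod_coord c @` prod_dom c, continuous (prod_param c)}.
Proof.
move=> u; rewrite prod_codomE inE => -[/= u1 u2] W [[A B] [/= nA nB] ABW].
have C1 : {for lsubmx u, continuous (param c.1)}.
  by apply: param_continuous; rewrite inE.
have C2 : {for rsubmx u, continuous (param c.2)}.
  by apply: param_continuous; rewrite inE.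
have N1 : nbhs u (lsubmx @^-1` (param c.1 @^-1` A)).
  by apply: continuous_lsubmx; exact: C1.
have N2 : nbhs u (rsubmx @^-1` (param c.2 @^-1` B)).
  by apply: continuous_rsubmx; exact: C2.
by apply: filterS2 N1 N2 => v vA vB; apply: ABW.
Qed.

Lemma prod_transition_smooth c c' (k : 'I_(n1 + n2)) :
  smooth_on (prod_coord c @` (prod_dom c `&` prod_dom c'))
    (fun u => prod_coord c' (prod_param c u) 0 k).
Proof.
move=> r; case: (split_ordP k) => j ->.
- rewrite (_ : (fun u => _) =
      (fun v => coord c'.1 (param c.1 v) 0 j) \o lsubmx); last first.
    by apply/funext => u; rewrite /prod_coord row_mxEl.
  apply: Ck_on_sub; last first.
    apply: Ck_on_comp_linear (transition_smooth c.1 c'.1 j r).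
      exact: continuous_lsubmx.
    move=> i; case: (split_ordP i) => i' ->.
      by right; exists i'; exact: lsubmx_delta_l.
    by left; exact: lsubmx_delta_r.
  move=> _ [p [[p1 p2] [p1' p2']] <-]; exists p.1 => //.
  by rewrite /prod_coord /= row_mxKl.
- rewrite (_ : (fun u => _) =
      (fun v => coord c'.2 (param c.2 v) 0 j) \o rsubmx); last first.
    by apply/funext => u; rewrite /prod_coord row_mxEr.
  apply: Ck_on_sub; last first.
    apply: Ck_on_comp_linear (transition_smooth c.2 c'.2 j r).
      exact: continuous_rsubmx.
    move=> i; case: (split_ordP i) => i' ->.
      by left; exact: rsubmx_delta_l.
    by right; exists i'; exact: rsubmx_delta_r.
  move=> _ [p [[p1 p2] [p1' p2']] <-]; exists p.2 => //.
  by rewrite /prod_coord /= row_mxKr.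
Qed.

Definition prod_manifold : smoothManifold R (n1 + n2) :=
  SmoothManifold prod_nonempty prod_hausdorff prod_second_countable
    prod_dom_open prod_dom_cover prod_codom_open prod_coordK
    prod_coord_continuous prod_param_continuous prod_transition_smooth.

End product.

Section coordinate_geometry.
Context {R : realType} {n : nat} (G : 'rV[R]_n -> 'M[R]_n).
Implicit Types (u : 'rV[R]_n) (f : 'rV[R]_n -> R) (i j k l : 'I_n).

Definition christoffel k i j u : R :=
  2^-1 * \sum_l invmx (G u) k l *
    (pderive i (fun w => G w j l) u + pderive j (fun w => G w i l) u
     - pderive l (fun w => G w i j) u).

(* The l-th component of R(d_i, d_j) d_k, where
   R(X, Y) = [nabla_X, nabla_Y] - nabla_[X, Y]. *)
Definition riemann l i j k u : R :=
  pderive i (christoffel l j k) u - pderive j (christoffel l i k) u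
  + \sum_m (christoffel l i m u * christoffel m j k u
            - christoffel l j m u * christoffel m i k u).

(* Ric(Y, Z) is the trace of X |-> R(X, Y) Z, so that the unit sphere of
   dimension n has Ric = (n - 1) g. *)
Definition ricci i j u : R := \sum_l riemann l l i j u.

Definition hessian f i j u : R :=
  pderive i (pderive j f) u - \sum_k christoffel k i j u * pderive k f u.

Definition laplacian f u : R :=
  \sum_i \sum_j invmx (G u) i j * hessian f i j u.

Definition gradient f u : 'rV[R]_n :=
  \row_i \sum_j invmx (G u) i j * pderive j f u.

Definition gnorm u (v : 'rV[R]_n) : R := Num.sqrt ((v *m G u *m v^T) 0 0).

End coordinate_geometry.

Section manifold_geometry.
Context {R : realType} {n : nat} {M : smoothManifold R n}.

(* Covariant 2-tensor fields as families of components: [g c p i j] is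
   g(d_i, d_j) at [p] for the coordinate frame of the chart [c], relevant only
   when [dom c p]. The transformation law is part of [riemannian_metric]. *)
Definition tensor2 := chart M -> M -> 'M[R]_n.

Definition chart_codom (c : chart M) : set 'rV[R]_n := coord c @` dom c.

(* Rows are indexed by the coordinates of [c], columns by those of [c']. *)
Definition transition_jacobian (c c' : chart M) (p : M) : 'M[R]_n :=
  'J (coord c' \o param c) (coord c p).

Definition riemannian_metric (g : tensor2) : Prop :=
  [/\ forall c p, dom c p ->
        (g c p)^T = g c p /\
        (forall v : 'rV[R]_n, v != 0 -> 0 < (v *m g c p *m v^T) 0 0),
      forall c c' p, dom c p -> dom c' p ->
        g c p = transition_jacobian c c' p *m g c' p *m
                (transition_jacobian c c' p)^T
    & forall c i j, smooth_on (chart_codom c) (fun u => g c (param c u) i j)].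

Definition Ric (g : tensor2) : tensor2 := fun c p =>
  \matrix_(i, j) ricci (g c \o param c) i j (coord c p).

Definition Hess (g : tensor2) (f : M -> R) : tensor2 := fun c p =>
  \matrix_(i, j) hessian (g c \o param c) (f \o param c) i j (coord c p).

(* The following two functions do not depend on the chart used around [p]. *)
Definition Laplacian (g : tensor2) (f : M -> R) (c : chart M) (p : M) : R :=
  laplacian (g c \o param c) (f \o param c) (coord c p).

Definition grad_norm (g : tensor2) (f : M -> R) (c : chart M) (p : M) : R :=
  let G := g c \o param c in
  gnorm G (coord c p) (gradient G (f \o param c) (coord c p)).

Definition einstein_metric (g : tensor2) (a : R) : Prop :=
  riemannian_metric g /\ (forall c p, dom c p -> Ric g c p = a *: g c p).

Definition smooth_family (T : \bar R) (f : R -> M -> R) : Prop :=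
  forall c, smooth_family_on T (chart_codom c) (fun t u => f t (param c u)).

Definition metric_family (T : \bar R) (g : R -> tensor2) : Prop :=
  (forall t, time_interval T t -> riemannian_metric (g t)) /\
  (forall c i j,
     smooth_family_on T (chart_codom c) (fun t u => g t c (param c u) i j)).

Definition hyperbolic_geometric_flow (T : \bar R) (g : R -> tensor2) : Prop :=
  metric_family T g /\
  (forall t c p i j, time_interval T t -> dom c p ->
     tderive2 T (fun s => g s c p i j) t = - 2 * Ric (g t) c p i j).

End manifold_geometry.

Arguments tensor2 {R n} M.

(* g1 (+) lam^2 g2, in the product charts. *)
Definition warped_metric (R : realType) (n1 n2 : nat)
    (M1 : smoothManifold R n1) (M2 : smoothManifold R n2)
    (g1 : tensor2 M1) (lam : M1 -> R) (g2 : tensor2 M2) :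
    tensor2 (prod_manifold M1 M2) :=
  fun c p => block_mx (g1 c.1 p.1) 0 0 (lam p.1 ^+ 2 *: g2 c.2 p.2).

(* Main.v *)
(* Let i, j, k be indices of the base and a, b of the fiber. In product
   charts the only Christoffel symbols of g1 + lam^2 g2 not inherited from a
   factor are Gamma^a_(i b) = (d_i lam / lam) delta^a_b and
   Gamma^k_(a b) = - lam (grad lam)^k (g2)_(a b). Contracting the curvature,
   with tr Hess = div grad on the base, gives
     Ric_ij = Ric1_ij - (m2 / lam) Hess(lam)_ij,
     Ric_ab = Ric2_ab - (lam Delta lam + (m2 - 1) |grad lam|^2) (g2)_ab.
   The base block of the flow is the first equation. For the second, divide a
   diagonal entry of the fiber block by the time-independent, positive (g2)_aa
   and use Delta lam^2 = 2 lam Delta lam + 2 |grad lam|^2. *)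
Require Import Defs.
From mathcomp Require Import all_boot all_order all_algebra.
From mathcomp Require Import all_classical all_reals all_analysis.
From mathcomp Require Import perm ring.

Set Implicit Arguments.
Unset Strict Implicit.
Unset Printing Implicit Defensive.

Import Order.TTheory GRing.Theory Num.Theory.
Import numFieldNormedType.Exports.

Local Open Scope classical_set_scope.
Local Open Scope ring_scope.

(** * Rules for partial derivatives, up to determinants and inverse matrices *)

Section partial_derivatives.
Context {R : realType} {n : nat}.
Implicit Types (f g : 'rV[R]_n -> R) (u : 'rV[R]_n) (k : 'I_n).

Lemma pderive_cst k (a : R) u : pderive k (fun=> a) u = 0.
Proof. by rewrite /pderive derive_cst. Qed.

Lemma pderiveM k f g u :
  derivable f u (delta_mx 0 k) -> derivable g u (delta_mx 0 k) ->
  pderive k (fun w => f w * g w) u = pderive k f u * g u + f u * pderive k g u.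
Proof.
move=> df dg; rewrite /pderive (deriveM df dg) /GRing.scale /=.
by rewrite addrC mulrC.
Qed.

Lemma pderive_sqr k f u : derivable f u (delta_mx 0 k) ->
  pderive k (fun w => f w ^+ 2) u = 2 * f u * pderive k f u.
Proof.
move=> df; rewrite (_ : (fun w => _) = fun w => f w * f w).
  by rewrite pderiveM//; ring.
by apply/funext => w; rewrite expr2.
Qed.

Lemma derivable_mul k f g u :
  derivable f u (delta_mx 0 k) -> derivable g u (delta_mx 0 k) ->
  derivable (fun w => f w * g w) u (delta_mx 0 k).
Proof. exact: derivableM. Qed.

Lemma derivable_bigsum k u m (F : 'I_m -> 'rV[R]_n -> R) :
  (forall i, derivable (F i) u (delta_mx 0 k)) ->
  derivable (fun w => \sum_i F i w) u (delta_mx 0 k).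
Proof.
move=> dF; rewrite (_ : (fun w => _) = \sum_i F i); first exact: derivable_sum.
by apply/funext => w; rewrite fct_sumE.
Qed.

Lemma pderive_sum k u m (F : 'I_m -> 'rV[R]_n -> R) :
  (forall i, derivable (F i) u (delta_mx 0 k)) ->
  pderive k (fun w => \sum_i F i w) u = \sum_i pderive k (F i) u.
Proof.
move=> dF; rewrite (_ : (fun w => _) = \sum_i F i); first exact: derive_sum.
by apply/funext => w; rewrite fct_sumE.
Qed.

(** A derivative at [u] sees only the germ of the function. This lets formulas valid only on the
    image of a chart be differentiated. *)
Lemma eq_pderive_on (D : set 'rV[R]_n) k f g u : open D -> D u ->
  {in D, f =1 g} -> pderive k f u = pderive k g u.
Proof.
move=> oD Du fg; apply: near_eq_derive.
near=> w; apply: fg; rewrite inE; near: w.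
exact: open_nbhs_nbhs.
Unshelve. all: by end_near. Qed.

Lemma derivable_prod (I : Type) (r : seq I) (P : pred I) k u
    (F : I -> 'rV[R]_n -> R) :
  (forall i, derivable (F i) u (delta_mx 0 k)) ->
  derivable (fun w => \prod_(i <- r | P i) F i w) u (delta_mx 0 k).
Proof.
move=> dF; elim: r => [|i r IH].
  rewrite (_ : (fun w => _) = fun=> 1); first exact: derivable_cst.
  by apply/funext => w; rewrite big_nil.
case Pi: (P i); last first.
  rewrite (_ : (fun w => _) = fun w => \prod_(j <- r | P j) F j w) //.
  by apply/funext => w; rewrite big_cons Pi.
rewrite (_ : (fun w => _) = fun w => F i w * \prod_(j <- r | P j) F j w).
  exact: derivable_mul.
by apply/funext => w; rewrite big_cons Pi.
Qed.

Lemma derivable_det m (A : 'rV[R]_n -> 'M[R]_m) k u :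
  (forall i j, derivable (fun w => A w i j) u (delta_mx 0 k)) ->
  derivable (fun w => \det (A w)) u (delta_mx 0 k).
Proof.
move=> dA; pose F (s : {perm 'I_m}) w := (-1) ^+ s * \prod_i A w i (s i).
(* The Leibniz expansion, reindexed by ordinals to match [derivable_bigsum]. *)
rewrite (_ : (fun w => _) = fun w => \sum_(i < #|{perm 'I_m}|) F (enum_val i) w).
  apply: derivable_bigsum => s; apply: derivable_mul.
    exact: derivable_cst.
  exact: derivable_prod.
by apply/funext => w; rewrite /determinant (reindex _ (onW_bij _ (enum_val_bij _))).
Qed.

(** Cramer's rule: near [u] the inverse is the adjugate divided by the determinant, and both are
    polynomial in the entries of [A]. *)
Lemma derivable_invmx m (D : set 'rV[R]_n) (A : 'rV[R]_n -> 'M[R]_m) i j k u :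
  open D -> D u -> (forall w, D w -> A w \in unitmx) ->
  (forall i j, derivable (fun w => A w i j) u (delta_mx 0 k)) ->
  derivable (fun w => invmx (A w) i j) u (delta_mx 0 k).
Proof.
move=> oD Du uA dA.
have : derivable (fun w => (\det (A w))^-1 * \adj (A w) i j) u (delta_mx 0 k).
  apply: derivable_mul.
    apply: derivableV; last exact: derivable_det.
    by rewrite -unitfE -unitmxE uA.
  rewrite (_ : (fun w => _) =
      (fun w => (-1) ^+ (j + i) * \det (row' j (col' i (A w))))).
    apply: derivable_mul; first exact: derivable_cst.
    apply: derivable_det => a b.
    rewrite (_ : (fun w => _) = fun w => A w (lift j a) (lift i b)) //.
    by apply/funext => w; rewrite !mxE.
  by apply/funext => w; rewrite mxE.
move=> dA'; apply: (near_eq_derivable _ dA'); near=> w.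
have Dw : D w by near: w; exact: open_nbhs_nbhs.
by rewrite /invmx uA// [RHS]mxE.
Unshelve. all: by end_near. Qed.

End partial_derivatives.

(** * Partial derivatives on a product of two coordinate spaces *)

Section block_coordinates.
Context {R : realType} {n1 n2 : nat}.
Implicit Types (f : 'rV[R]_n1 -> R) (g : 'rV[R]_n2 -> R) (u : 'rV[R]_(n1 + n2)).

Lemma pderive_ll f i u :
  pderive (lshift n2 i) (fun w => f (lsubmx w)) u = pderive i f (lsubmx u).
Proof.
by rewrite /pderive (derive_comp_linear (@lsubmx R 1 n1 n2)) /= lsubmx_delta_l.
Qed.

Lemma pderive_rl f i u :
  pderive (rshift n1 i) (fun w => f (lsubmx w)) u = 0.
Proof.
rewrite /pderive (derive_comp_linear (@lsubmx R 1 n1 n2)) /= lsubmx_delta_r.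
by rewrite derive0.
Qed.

Lemma pderive_rr g i u :
  pderive (rshift n1 i) (fun w => g (rsubmx w)) u = pderive i g (rsubmx u).
Proof.
by rewrite /pderive (derive_comp_linear (@rsubmx R 1 n1 n2)) /= rsubmx_delta_r.
Qed.

Lemma pderive_lr g i u :
  pderive (lshift n2 i) (fun w => g (rsubmx w)) u = 0.
Proof.
rewrite /pderive (derive_comp_linear (@rsubmx R 1 n1 n2)) /= rsubmx_delta_l.
by rewrite derive0.
Qed.

Lemma pderive_l_mul f g i u : derivable f (lsubmx u) (delta_mx 0 i) ->
  pderive (lshift n2 i) (fun w => f (lsubmx w) * g (rsubmx w)) u =
  pderive i f (lsubmx u) * g (rsubmx u).
Proof.
move=> df; rewrite (@pderiveM _ _ _ (fun w => f (lsubmx w)) (fun w => g (rsubmx w))).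
- by rewrite pderive_ll pderive_lr mulr0 addr0.
- apply: (@derivable_comp_linear _ _ _ (@lsubmx R 1 n1 n2)).
  by rewrite /= lsubmx_delta_l.
- apply: (@derivable_comp_linear _ _ _ (@rsubmx R 1 n1 n2)).
  by rewrite /= rsubmx_delta_l; exact: derivable0.
Qed.

Lemma pderive_r_mul f g i u : derivable g (rsubmx u) (delta_mx 0 i) ->
  pderive (rshift n1 i) (fun w => f (lsubmx w) * g (rsubmx w)) u =
  f (lsubmx u) * pderive i g (rsubmx u).
Proof.
move=> dg; rewrite (@pderiveM _ _ _ (fun w => f (lsubmx w)) (fun w => g (rsubmx w))).
- by rewrite pderive_rl pderive_rr mul0r add0r.
- apply: (@derivable_comp_linear _ _ _ (@lsubmx R 1 n1 n2)).
  by rewrite /= lsubmx_delta_r; exact: derivable0.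
- apply: (@derivable_comp_linear _ _ _ (@rsubmx R 1 n1 n2)).
  by rewrite /= rsubmx_delta_r.
Qed.

End block_coordinates.

Lemma sumr_delta {R : nzRingType} n (F : 'I_n -> R) j :
  \sum_i F i * (i == j)%:R = F j.
Proof.
rewrite (bigD1 j)//= eqxx mulr1 big1 ?addr0// => i /negPf ->.
by rewrite mulr0.
Qed.

(** * Levi-Civita calculus of one metric in coordinates *)

Section metric_coordinates.
Context {R : realType} {n : nat}.
Implicit Types (u : 'rV[R]_n) (f : 'rV[R]_n -> R) (D : set 'rV[R]_n)
  (G : 'rV[R]_n -> 'M[R]_n).

Definition metric_components_on D G : Prop :=
  [/\ open D, forall u, D u -> (G u)^T = G u,
      forall u, D u -> G u \in unitmx
    & forall u i j k, D u -> derivable (fun w => G w i j) u (delta_mx 0 k)].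

Context {D : set 'rV[R]_n} {G : 'rV[R]_n -> 'M[R]_n}.
Hypothesis GD : metric_components_on D G.

Let metric_pderive_sym u i j k : D u ->
  pderive k (fun w => G w i j) u = pderive k (fun w => G w j i) u.
Proof.
case: GD => oD sG _ _ Du; apply: (eq_pderive_on _ oD Du) => w.
by rewrite inE => Dw; rewrite -[in LHS](sG w Dw) mxE.
Qed.

(** This is [nabla g = 0] in matrix form. Lowering the upper index of [Gamma] gives the Christoffel
    symbols of the first kind; adding the transpose cancels their part antisymmetric in the two
    indices. *)
Lemma metric_compatibility u k : D u ->
  let Gamma := \matrix_(a, b) christoffel G a k b u in
  (\matrix_(i, j) pderive k (fun w => G w i j) u) =
    G u *m Gamma + Gamma^T *m G u.
Proof.
move=> Du Gamma; case: (GD) => _ sG uG _.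
have GGamma : G u *m Gamma = \matrix_(a, b)
    (2^-1 * (pderive k (fun w => G w b a) u + pderive b (fun w => G w k a) u
             - pderive a (fun w => G w k b) u)).
  have -> : Gamma = invmx (G u) *m \matrix_(a, b)
    (2^-1 * (pderive k (fun w => G w b a) u + pderive b (fun w => G w k a) u
             - pderive a (fun w => G w k b) u)).
    apply/matrixP => a b; rewrite !mxE /christoffel mulr_sumr.
    by apply: eq_bigr => l _; rewrite mxE mulrCA.
  by rewrite mulmxA mulmxV ?uG// mul1mx.
have -> : Gamma^T *m G u = (G u *m Gamma)^T by rewrite trmx_mul sG.
apply/matrixP => i j; rewrite GGamma !mxE (metric_pderive_sym j i)//.
by field.
Qed.

Lemma derivable_inv_metric u i j k : D u ->
  derivable (fun w => invmx (G w) i j) u (delta_mx 0 k).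
Proof.
move=> Du; case: GD => oD _ uG dG.
by apply: (derivable_invmx oD) => // a b; exact: dG.
Qed.

(** Metric compatibility for the inverse metric: differentiate [G * G^-1 = 1], solve for the
    derivative of [G^-1], and substitute [metric_compatibility]. *)
Lemma pderive_inv_metric u i j k : D u ->
  pderive k (fun w => invmx (G w) i j) u =
  - \sum_a (christoffel G i k a u * invmx (G u) a j
            + invmx (G u) i a * christoffel G j k a u).
Proof.
move=> Du; case: (GD) => oD sG uG dG.
set Gamma := \matrix_(a, b) christoffel G a k b u.
pose dI := \matrix_(a, b) pderive k (fun w => invmx (G w) a b) u.
have prodrule : (\matrix_(a, b) pderive k (fun w => G w a b) u) *m invmx (G u)
    + G u *m dI = 0.
  apply/matrixP => a b; rewrite !mxE -big_split /=.
  transitivity (pderive k (fun w => \sum_c G w a c * invmx (G w) c b) u).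
    rewrite pderive_sum => [|c].
      apply: eq_bigr => c _; rewrite pderiveM ?mxE//; first exact: dG.
      exact: derivable_inv_metric.
    by apply: derivable_mul; [exact: dG | exact: derivable_inv_metric].
  rewrite -[RHS](pderive_cst k ((1%:M : 'M[R]_n) a b) u).
  apply: (eq_pderive_on _ oD Du) => w; rewrite inE => Dw.
  by rewrite -(mulmxV (uG _ Dw)) mxE.
have : dI = - (Gamma *m invmx (G u) + invmx (G u) *m Gamma^T).
  rewrite -[LHS](mulKmx (uG _ Du)).
  move/eqP: prodrule; rewrite addrC addr_eq0 => /eqP ->.
  rewrite metric_compatibility// -/Gamma mulmxDl mulmxN mulmxDr.
  by rewrite -!mulmxA mulKmx ?uG// mulmxV ?uG// mulmx1.
move=> /matrixP /(_ i j); rewrite !mxE -big_split /= => ->.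
by congr (- _); apply: eq_bigr => a _; rewrite !mxE.
Qed.

(** Differentiating the inverse metric inside the gradient yields two Christoffel terms. One cancels
    the connection term of the divergence, the other is the Christoffel term of the Hessian. *)
Lemma divergence_gradient f u : D u ->
  (forall i k, derivable (pderive i f) u (delta_mx 0 k)) ->
  \sum_k (pderive k (fun w => gradient G f w 0 k) u
          + \sum_m christoffel G k k m u * gradient G f u 0 m) =
  laplacian G f u.
Proof.
move=> Du d2f.
have gradE k : (fun w => gradient G f w 0 k) =
    (fun w => \sum_j invmx (G w) k j * pderive j f w).
  by apply/funext => w; rewrite mxE.
have dgrad k : pderive k (fun w => gradient G f w 0 k) u =
    \sum_j invmx (G u) k j * pderive k (pderive j f) u
    - (\sum_m christoffel G k k m u * gradient G f u 0 m
       + \sum_j \sum_m invmx (G u) k m * christoffel G j k m u * pderive j f u).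
  rewrite gradE pderive_sum => [|j]; last first.
    by apply: derivable_mul; [exact: derivable_inv_metric | exact: d2f].
  have -> : \sum_m christoffel G k k m u * gradient G f u 0 m =
      \sum_j \sum_m christoffel G k k m u * invmx (G u) m j * pderive j f u.
    rewrite exchange_big /=; apply: eq_bigr => m _.
    by rewrite mxE mulr_sumr; apply: eq_bigr => j _; rewrite mulrA.
  rewrite -!big_split -sumrB; apply: eq_bigr => j _ /=.
  rewrite pderiveM; [|exact: derivable_inv_metric|exact: d2f].
  rewrite pderive_inv_metric// big_split /= mulNr mulrDl !mulr_suml.
  by rewrite [LHS]addrC.
rewrite /laplacian; apply: eq_bigr => k _; rewrite dgrad.
have cancelQ (a b d : R) : a - (b + d) + b = a - d by ring.
rewrite cancelQ.
under [RHS]eq_bigr do rewrite /hessian mulrBr.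
rewrite !sumrB; congr (_ - _); rewrite exchange_big /=.
apply: eq_bigr => m _; rewrite mulr_sumr.
by apply: eq_bigr => j _; rewrite -mulrA.
Qed.

(** The Christoffel part is of first order in [f], so only the second derivative contributes the
    extra term [df (x) df]. *)
Lemma hessian_sqr f u i j : D u ->
  (forall v k, D v -> derivable f v (delta_mx 0 k)) ->
  derivable (pderive j f) u (delta_mx 0 i) ->
  hessian G (fun w => f w ^+ 2) i j u =
  2 * f u * hessian G f i j u + 2 * (pderive i f u * pderive j f u).
Proof.
move=> Du df d2f; case: (GD) => oD _ _ _; rewrite /hessian.
rewrite (@eq_pderive_on _ _ D _ _ (fun w => 2 * f w * pderive j f w))//; last first.
  by move=> w; rewrite inE => Dw; rewrite pderive_sqr//; exact: df.
have -> : pderive i (fun w => 2 * f w * pderive j f w) u =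
    2 * (pderive i f u * pderive j f u + f u * pderive i (pderive j f) u).
  rewrite (_ : (fun w => _) = (fun w => cst 2 w * (f w * pderive j f w))).
    rewrite pderiveM; [|exact: derivable_cst|by apply: derivable_mul; [exact: df|]].
    by rewrite pderive_cst mul0r add0r pderiveM//; exact: df.
  by apply/funext => w; rewrite mulrA.
have -> : \sum_k christoffel G k i j u * pderive k (fun w => f w ^+ 2) u =
    2 * f u * \sum_k christoffel G k i j u * pderive k f u.
  rewrite mulr_sumr; apply: eq_bigr => k _.
  by rewrite pderive_sqr; [ring|exact: df].
by ring.
Qed.

(** The trace of [hessian_sqr]; the last sum is [|grad f|^2] written as [df(grad f)]. *)
Lemma laplacian_sqr f u : D u ->
  (forall v k, D v -> derivable f v (delta_mx 0 k)) ->
  (forall i k, derivable (pderive i f) u (delta_mx 0 k)) ->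
  laplacian G (fun w => f w ^+ 2) u =
  2 * f u * laplacian G f u + 2 * \sum_k gradient G f u 0 k * pderive k f u.
Proof.
move=> Du df d2f; rewrite /laplacian !mulr_sumr -big_split.
apply: eq_bigr => i _ /=; rewrite mxE mulr_suml !mulr_sumr -big_split.
apply: eq_bigr => j _ /=; rewrite hessian_sqr//; ring.
Qed.

End metric_coordinates.

(** * Christoffel symbols and Ricci curvature of a warped product *)

Section warped_product.
Context {R : realType} {n1 n2 : nat}.
Context {D1 : set 'rV[R]_n1} {G1 : 'rV[R]_n1 -> 'M[R]_n1} {phi : 'rV[R]_n1 -> R}.
Context {D2 : set 'rV[R]_n2} {G2 : 'rV[R]_n2 -> 'M[R]_n2}.
Hypothesis G1D : metric_components_on D1 G1.
Hypothesis G2D : metric_components_on D2 G2.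
Hypothesis phi_neq0 : forall v, D1 v -> phi v != 0.
Hypothesis dphi : forall v i, D1 v -> derivable phi v (delta_mx 0 i).
Hypothesis d2phi :
  forall v i j, D1 v -> derivable (pderive i phi) v (delta_mx 0 j).

Let W (u : 'rV[R]_(n1 + n2)) : 'M[R]_(n1 + n2) :=
  block_mx (G1 (lsubmx u)) 0 0 (phi (lsubmx u) ^+ 2 *: G2 (rsubmx u)).
Let D : set 'rV[R]_(n1 + n2) := (lsubmx @^-1` D1) `&` (rsubmx @^-1` D2).

Let open_D : open D.
Proof.
case: G1D => oD1 _ _ _; case: G2D => oD2 _ _ _.
apply: openI; apply: open_comp => // u _.
- exact: continuous_lsubmx.
- exact: continuous_rsubmx.
Qed.

Section metric_derivatives.
Context {u : 'rV[R]_(n1 + n2)}.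
Hypothesis Du : D u.
Let v := lsubmx u.
Let w := rsubmx u.
Let D1v : D1 v := Du.1.
Let D2w : D2 w := Du.2.

Let pW_ll (k : 'I_(n1 + n2)) i j :
  pderive k (fun z => W z (lshift n2 i) (lshift n2 j)) u =
  pderive k (fun z => G1 (lsubmx z) i j) u.
Proof. by congr pderive; apply/funext => z; rewrite block_mxEul. Qed.

Let pW_lr (k : 'I_(n1 + n2)) i j :
  pderive k (fun z => W z (lshift n2 i) (rshift n1 j)) u = 0.
Proof.
rewrite -[RHS](pderive_cst k 0 u).
by congr pderive; apply/funext => z; rewrite block_mxEur mxE.
Qed.

Let pW_rl (k : 'I_(n1 + n2)) i j :
  pderive k (fun z => W z (rshift n1 i) (lshift n2 j)) u = 0.
Proof.
rewrite -[RHS](pderive_cst k 0 u).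
by congr pderive; apply/funext => z; rewrite block_mxEdl mxE.
Qed.

Let pW_rr (k : 'I_(n1 + n2)) i j :
  pderive k (fun z => W z (rshift n1 i) (rshift n1 j)) u =
  pderive k (fun z => phi (lsubmx z) ^+ 2 * G2 (rsubmx z) i j) u.
Proof. by congr pderive; apply/funext => z; rewrite block_mxEdr mxE. Qed.

Let pW_rr_l k i j :
  pderive (lshift n2 k) (fun z => W z (rshift n1 i) (rshift n1 j)) u =
  2 * phi v * pderive k phi v * G2 w i j.
Proof.
rewrite pW_rr.
have dphi2 : derivable (fun z => phi z ^+ 2) v (delta_mx 0 k).
  rewrite (_ : (fun z => _) = (fun z => phi z * phi z)).
    by apply: derivable_mul; exact: dphi.
  by apply/funext => z; rewrite expr2.
rewrite (pderive_l_mul (fun z => G2 z i j) dphi2) pderive_sqr//.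
exact: dphi.
Qed.

Let pW_rr_r k i j :
  pderive (rshift n1 k) (fun z => W z (rshift n1 i) (rshift n1 j)) u =
  phi v ^+ 2 * pderive k (fun z => G2 z i j) w.
Proof.
rewrite pW_rr; case: G2D => _ _ _ dG2.
exact: (pderive_r_mul (fun z => phi z ^+ 2) (dG2 _ i j k D2w)).
Qed.

Let pW_ll_l k i j :
  pderive (lshift n2 k) (fun z => W z (lshift n2 i) (lshift n2 j)) u =
  pderive k (fun z => G1 z i j) v.
Proof. by rewrite pW_ll (pderive_ll (fun z => G1 z i j)). Qed.

Let pW_ll_r k i j :
  pderive (rshift n1 k) (fun z => W z (lshift n2 i) (lshift n2 j)) u = 0.
Proof. by rewrite pW_ll (pderive_rl (fun z => G1 z i j)). Qed.

Let pW := (pW_lr, pW_rl, pW_rr_l, pW_rr_r, pW_ll_l, pW_ll_r).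

Let phi2_unit : phi v ^+ 2 \is a GRing.unit.
Proof. by rewrite unitfE expf_neq0// phi_neq0. Qed.

Let invW : invmx (W u) =
  block_mx (invmx (G1 v)) 0 0 ((phi v ^+ 2)^-1 *: invmx (G2 w)).
Proof.
case: G1D => _ _ uG1 _; case: G2D => _ _ uG2 _.
rewrite /W invmx_block_diag; first by rewrite invmxZ// unitmxZ// uG2.
by rewrite unitmxE det_lblock unitrM -!unitmxE unitmxZ// uG1// uG2.
Qed.

Let invG2K i j : \sum_l invmx (G2 w) i l * G2 w l j = (i == j)%:R.
Proof.
case: G2D => _ _ uG2 _.
by have /matrixP/(_ i j) := mulVmx (uG2 _ D2w); rewrite !mxE.
Qed.

Let G2sym i j : G2 w i j = G2 w j i.
Proof. by case: G2D => _ sG2 _ _; rewrite -[in LHS](sG2 _ D2w) mxE. Qed.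

(** In these names the three letters place the upper index, then the two lower ones: [l] in the
    base, [r] in the fiber. As the inverse metric is block diagonal, the sum over [l] keeps only the
    block of the upper index. *)
Lemma warped_christoffel_lll k i j :
  christoffel W (lshift n2 k) (lshift n2 i) (lshift n2 j) u =
  christoffel G1 k i j v.
Proof.
rewrite /christoffel invW big_split_ord /= [X in _ + X]big1 ?addr0.
  by congr (_ * _); apply: eq_bigr => l _; rewrite !pW block_mxEul.
by move=> l _; rewrite block_mxEur mxE mul0r.
Qed.

Lemma warped_christoffel_rll k i j :
  christoffel W (rshift n1 k) (lshift n2 i) (lshift n2 j) u = 0.
Proof.
rewrite /christoffel invW big_split_ord /= !big1 ?addr0 ?mulr0//.
  by move=> l _; rewrite !pW addr0 subr0 mulr0.
by move=> l _; rewrite block_mxEdl mxE mul0r.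
Qed.

Lemma warped_christoffel_llr k i j :
  christoffel W (lshift n2 k) (lshift n2 i) (rshift n1 j) u = 0.
Proof.
rewrite /christoffel invW big_split_ord /= !big1 ?addr0 ?mulr0//.
  by move=> l _; rewrite block_mxEur mxE mul0r.
by move=> l _; rewrite !pW addr0 subr0 mulr0.
Qed.

Lemma warped_christoffel_lrl k i j :
  christoffel W (lshift n2 k) (rshift n1 i) (lshift n2 j) u = 0.
Proof.
rewrite /christoffel invW big_split_ord /= !big1 ?addr0 ?mulr0//.
  by move=> l _; rewrite block_mxEur mxE mul0r.
by move=> l _; rewrite !pW addr0 subr0 mulr0.
Qed.

(** Only the base derivative of [phi ^+ 2] survives: the factor [2 * phi] meets [2^-1] and
    [phi ^- 2], and [G2] contracts with its inverse to a Kronecker delta. *)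
Lemma warped_christoffel_rlr k i j :
  christoffel W (rshift n1 k) (lshift n2 i) (rshift n1 j) u =
  pderive i phi v / phi v * (k == j)%:R.
Proof.
rewrite /christoffel invW big_split_ord /= big1 ?add0r; last first.
  by move=> l _; rewrite block_mxEdl mxE mul0r.
rewrite -invG2K !mulr_sumr; apply: eq_bigr => l _.
rewrite !pW block_mxEdr mxE (G2sym l j) addr0 subr0.
by field; exact: phi_neq0.
Qed.

Lemma warped_christoffel_rrl k i j :
  christoffel W (rshift n1 k) (rshift n1 i) (lshift n2 j) u =
  pderive j phi v / phi v * (k == i)%:R.
Proof.
rewrite /christoffel invW big_split_ord /= big1 ?add0r; last first.
  by move=> l _; rewrite block_mxEdl mxE mul0r.
rewrite -invG2K !mulr_sumr; apply: eq_bigr => l _.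
rewrite !pW block_mxEdr mxE (G2sym l i) add0r subr0.
by field; exact: phi_neq0.
Qed.

(** The only surviving term is the subtracted one, the base derivative of [phi ^+ 2 * G2]; raising
    its index produces the gradient. *)
Lemma warped_christoffel_lrr k i j :
  christoffel W (lshift n2 k) (rshift n1 i) (rshift n1 j) u =
  - phi v * gradient G1 phi v 0 k * G2 w i j.
Proof.
rewrite /christoffel invW big_split_ord /= [X in _ + X]big1 ?addr0; last first.
  by move=> l _; rewrite block_mxEur mxE mul0r.
rewrite mxE !mulr_sumr mulr_suml; apply: eq_bigr => l _.
by rewrite !pW block_mxEul; field.
Qed.

(** Since [phi] is constant along the fiber, [phi ^+ 2] factors out and cancels against the inverse
    metric. *)
Lemma warped_christoffel_rrr k i j :
  christoffel W (rshift n1 k) (rshift n1 i) (rshift n1 j) u =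
  christoffel G2 k i j w.
Proof.
rewrite /christoffel invW big_split_ord /= big1 ?add0r; last first.
  by move=> l _; rewrite block_mxEdl mxE mul0r.
congr (_ * _); apply: eq_bigr => l _.
by rewrite !pW block_mxEdr mxE; field; exact: phi_neq0.
Qed.

End metric_derivatives.

Let in_D z : z \in D -> D z. Proof. by rewrite inE. Qed.

Section curvature.
Context {u : 'rV[R]_(n1 + n2)}.
Hypothesis Du : D u.
Let v := lsubmx u.
Let w := rsubmx u.
Let D1v : D1 v := Du.1.
Let D2w : D2 w := Du.2.

Let Gamma := (warped_christoffel_lll Du, warped_christoffel_rll Du,
  warped_christoffel_llr Du, warped_christoffel_lrl Du,
  warped_christoffel_rlr Du, warped_christoffel_rrl Du,
  warped_christoffel_lrr Du, warped_christoffel_rrr Du).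

(** The curvature differentiates Christoffel symbols as functions, so their values are first
    replaced on the whole open set [D]. *)
Let pGamma_lll (a : 'I_(n1 + n2)) k i j :
  pderive a (christoffel W (lshift n2 k) (lshift n2 i) (lshift n2 j)) u =
  pderive a (fun z => christoffel G1 k i j (lsubmx z)) u.
Proof.
by apply: (eq_pderive_on _ open_D Du) => z /in_D Dz; rewrite warped_christoffel_lll.
Qed.

Let pGamma_rll (a : 'I_(n1 + n2)) k i j :
  pderive a (christoffel W (rshift n1 k) (lshift n2 i) (lshift n2 j)) u = 0.
Proof.
rewrite -[RHS](pderive_cst a 0 u).
by apply: (eq_pderive_on _ open_D Du) => z /in_D Dz; rewrite warped_christoffel_rll.
Qed.

Let pGamma_llr (a : 'I_(n1 + n2)) k i j :
  pderive a (christoffel W (lshift n2 k) (lshift n2 i) (rshift n1 j)) u = 0.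
Proof.
rewrite -[RHS](pderive_cst a 0 u).
by apply: (eq_pderive_on _ open_D Du) => z /in_D Dz; rewrite warped_christoffel_llr.
Qed.

Let pGamma_rrl i k j l :
  pderive (lshift n2 i) (christoffel W (rshift n1 k) (rshift n1 l) (lshift n2 j)) u
  = (pderive i (pderive j phi) v / phi v
     - pderive i phi v * pderive j phi v / phi v ^+ 2) * (k == l)%:R.
Proof.
pose f y := pderive j phi y / phi y * (k == l)%:R.
transitivity (pderive (lshift n2 i) (fun z => f (lsubmx z)) u).
  by apply: (eq_pderive_on _ open_D Du) => z /in_D Dz; rewrite warped_christoffel_rrl.
rewrite pderive_ll -/v /f.
have dinv : derivable (fun y => (phi y)^-1) v (delta_mx 0 i).
  by apply: derivableV; [exact: phi_neq0|exact: dphi].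
rewrite (pderiveM (derivable_mul (@d2phi v j i D1v) dinv)); last exact: derivable_cst.
rewrite pderive_cst mulr0 addr0 (pderiveM (@d2phi v j i D1v) dinv).
have -> : pderive i (fun y => (phi y)^-1) v = - phi v ^- 2 * pderive i phi v.
  by rewrite /pderive deriveV//; [exact: phi_neq0|exact: dphi].
congr (_ * _).
by field; exact: phi_neq0.
Qed.

Let pGamma_lrr a k i j :
  pderive (lshift n2 a) (christoffel W (lshift n2 k) (rshift n1 i) (rshift n1 j)) u
  = - (pderive a phi v * gradient G1 phi v 0 k
       + phi v * pderive a (fun z => gradient G1 phi z 0 k) v) * G2 w i j.
Proof.
pose f y := - phi y * gradient G1 phi y 0 k.
transitivity (pderive (lshift n2 a)
    (fun z => f (lsubmx z) * (fun y => G2 y i j) (rsubmx z)) u).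
  by apply: (eq_pderive_on _ open_D Du) => z /in_D Dz; rewrite warped_christoffel_lrr.
have dgrad : derivable (fun z => gradient G1 phi z 0 k) v (delta_mx 0 a).
  rewrite (_ : (fun z => _) =
      (fun z => \sum_l invmx (G1 z) k l * pderive l phi z)).
    apply: derivable_bigsum => l; apply: derivable_mul; last exact: d2phi.
    exact: (derivable_inv_metric G1D).
  by apply/funext => z; rewrite mxE.
have dprod := derivable_mul (@dphi v a D1v) dgrad.
(* The sign becomes a constant factor so that the product rule covers it. *)
have fE : f = (fun y => cst (-1) y * (phi y * gradient G1 phi y 0 k)).
  by apply/funext => y; rewrite /f /= mulN1r mulNr.
have dN := derivable_mul (derivable_cst (-1 : R) v (delta_mx 0 a)) dprod.
rewrite fE (pderive_l_mul (fun y => G2 y i j) dN) (pderiveM (derivable_cst _ _ _) dprod).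
rewrite pderive_cst mul0r add0r (pderiveM (@dphi v a D1v) dgrad) /=.
by rewrite mulN1r.
Qed.

Let pGamma_rrr a k i j :
  pderive (rshift n1 a) (christoffel W (rshift n1 k) (rshift n1 i) (rshift n1 j)) u
  = pderive a (christoffel G2 k i j) w.
Proof.
rewrite -pderive_rr.
by apply: (eq_pderive_on _ open_D Du) => z /in_D Dz; rewrite warped_christoffel_rrr.
Qed.

Lemma warped_ricci_base i j :
  ricci W (lshift n2 i) (lshift n2 j) u =
  ricci G1 i j v - n2%:R / phi v * hessian G1 phi i j v.
Proof.
rewrite /ricci big_split_ord /=; congr (_ + _).
  apply: eq_bigr => l _; rewrite /riemann !pGamma_lll.
  rewrite (pderive_ll (christoffel G1 l i j)) (pderive_ll (christoffel G1 l l j)).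
  rewrite big_split_ord /= [X in _ + (_ + X)]big1 ?addr0.
    by congr (_ + _); apply: eq_bigr => m _; rewrite !Gamma.
  by move=> m _; rewrite !Gamma !mul0r subrr.
(* Every fiber direction contributes the same amount: the product of first derivatives of [phi]
   coming from the quotient rule cancels against the fiber part of the quadratic Christoffel
   terms. *)
rewrite (eq_bigr (fun=> - (phi v)^-1 * hessian G1 phi i j v)).
  by rewrite sumr_const card_ord -mulr_natl; ring.
move=> l _; rewrite /riemann pGamma_rll pGamma_rrl eqxx big_split_ord /=.
under eq_bigr do rewrite !Gamma eqxx.
under [X in _ + (_ + X)]eq_bigr do rewrite !Gamma mulr0 sub0r.
rewrite sumrN; under [X in _ + (_ - X)]eq_bigr do rewrite mulrA.
rewrite sumr_delta eqxx /= mulr1n /hessian -/v.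
rewrite (eq_bigr (fun m => (phi v)^-1 * (christoffel G1 m i j v * pderive m phi v))).
  by rewrite -mulr_sumr; field; exact: phi_neq0.
by move=> m _; rewrite mul0r subr0; ring.
Qed.

Lemma warped_ricci_fiber a b :
  ricci W (rshift n1 a) (rshift n1 b) u =
  ricci G2 a b w
  - (phi v * laplacian G1 phi v
     + (n2%:R - 1) * \sum_k gradient G1 phi v 0 k * pderive k phi v) * G2 w a b.
Proof.
rewrite /ricci big_split_ord /=.
(* Base directions: the term [d_k phi * grad^k] from the product rule cancels against the quadratic
   terms with a fiber index, which leaves the divergence of the gradient. *)
rewrite (eq_bigr (fun k => - (phi v * G2 w a b) *
    (pderive k (fun z => gradient G1 phi z 0 k) v
     + \sum_m christoffel G1 k k m v * gradient G1 phi v 0 m))); last first.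
  move=> k _; rewrite /riemann pGamma_lrr pGamma_llr big_split_ord /=.
  under eq_bigr do rewrite !Gamma.
  under [X in _ + (_ + X)]eq_bigr do rewrite !Gamma mul0r sub0r.
  rewrite sumrN; under [X in _ + (_ - X)]eq_bigr do rewrite mulrA.
  rewrite sumr_delta.
  rewrite (eq_bigr (fun m => - (phi v * G2 w a b) *
      (christoffel G1 k k m v * gradient G1 phi v 0 m))).
    by rewrite -mulr_sumr; field; exact: phi_neq0.
  by move=> m _; rewrite mul0r subr0; ring.
rewrite -mulr_sumr (divergence_gradient G1D)//; last by move=> i k; exact: d2phi.
(* Fiber directions: the first correction occurs [n2] times, and the one with [l == a] gives one
   copy back, whence the factor [n2%:R - 1]. *)
rewrite (eq_bigr (fun l => riemann G2 l l a b w
    + (- G2 w a b * \sum_k gradient G1 phi v 0 k * pderive k phi v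
       + (\sum_k gradient G1 phi v 0 k * pderive k phi v * G2 w l b)
         * (l == a)%:R))); last first.
  move=> l _; rewrite /riemann !pGamma_rrr big_split_ord /=.
  rewrite [X in _ + X]addrC addrA; congr (_ + _ + _).
    by apply: eq_bigr => m _; rewrite !Gamma.
  rewrite mulr_sumr mulr_suml -big_split; apply: eq_bigr => m _ /=.
  by rewrite !Gamma eqxx /= mulr1n; field; exact: phi_neq0.
rewrite !big_split /= sumr_delta sumr_const card_ord -mulr_natl -mulr_suml.
by ring.
Qed.

End curvature.
End warped_product.

(** * Time derivatives relative to the half-open interval *)

Section time_derivatives.
Context {R : realType} {T : \bar R}.
Implicit Types (f g : R -> R) (t k : R).

(* Points of the half-open interval accumulate from the right. *)
Lemma time_interval_proper t : time_interval T t ->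
  ProperFilter (within (time_interval T) t^').
Proof.
move=> [t0 tT]; apply: Build_ProperFilter => tA.
suff : \forall s \near t^'+, False by move=> /filter_ex[].
have IT : \forall s \near t^'+, (s%:E < T)%E.
  case: T tT => [r|_|//]; last by near=> s; rewrite ltry.
  by rewrite lte_fin => tr; near=> s; rewrite lte_fin; near: s; exact: nbhs_right_lt.
have tA' : \forall s \near t^'+, s != t -> time_interval T s -> False.
  exact: (@cvg_within _ (nbhs t) _ (fun s => t < s) _ tA).
near=> s.
have ts : t < s by near: s; exact: nbhs_right_gt.
have sA : s != t -> time_interval T s -> False by near: s.
apply: sA; first by rewrite gt_eqF.
split; first exact: le_trans t0 (ltW ts).
by near: s.
Unshelve. all: by end_near. Qed.

Lemma eq_tderive f g t : time_interval T t ->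
  (forall s, time_interval T s -> f s = g s) -> tderive T f t = tderive T g t.
Proof.
move=> It fg; rewrite /tderive.
(* [lim] is a function of the filter, so equality of the two image filters is enough. *)
suff -> : (tquotient f t s @[s --> within (time_interval T) t^']) =
          (tquotient g t s @[s --> within (time_interval T) t^']) by [].
have FF : Filter (within (time_interval T) t^').
  by apply: filter_filter; exact: time_interval_proper.
have quot_eq : \forall s \near within (time_interval T) t^',
    tquotient f t s = tquotient g t s.
  by apply: filterS (withinT _ _) => s Is; rewrite /tquotient !fg.
apply/seteqP; split; apply: near_eq_cvg; apply: filterS quot_eq => s // ->.
Qed.

Lemma tderiveZ k f t : time_interval T t -> tderivable T f t ->
  tderive T (fun s => k * f s) t = k * tderive T f t.
Proof.
move=> It df; rewrite /tderive.
have FF := time_interval_proper It.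
rewrite (_ : tquotient (fun s => k * f s) t = fun s => k * tquotient f t s).
  by apply: cvg_lim => //; exact: cvgMl_tmp.
by apply/funext => s; rewrite /tquotient -mulrBr mulrA.
Qed.

(** The outer derivative sees the inner one at nearby times as well, so the scalar is first
    extracted from [tderive] on the whole interval. *)
Lemma tderive2Z k f t : time_interval T t ->
  (forall s, time_interval T s -> tderivable T f s) ->
  tderivable T (tderive T f) t ->
  tderive2 T (fun s => k * f s) t = k * tderive2 T f t.
Proof.
move=> It df d2f; rewrite /tderive2 -tderiveZ//.
by apply: eq_tderive => // s Is; rewrite tderiveZ//; exact: df.
Qed.

End time_derivatives.

(** * From Riemannian metrics on manifolds to components in a chart *)

Section charts.
Context {R : realType} {n : nat} {M : smoothManifold R n}.
Implicit Types (g : tensor2 M) (a : chart M) (x : M).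

Lemma chart_codomP a u : chart_codom a u -> dom a (param a u).
Proof. by move=> [x ax <-]; rewrite coordK ?inE. Qed.

(** A nonzero vector in the left kernel would make the quadratic form vanish. *)
Lemma posdef_unitmx m (A : 'M[R]_m) :
  (forall v : 'rV[R]_m, v != 0 -> 0 < (v *m A *m v^T) 0 0) -> A \in unitmx.
Proof.
move=> A_gt0; rewrite -row_free_unit -kermx_eq0; apply: contraT => /rowV0Pn.
move=> [v /sub_kermxP vA v0]; have := A_gt0 _ v0.
by rewrite vA mul0mx mxE ltxx.
Qed.

Lemma riemannian_metric_components g a : riemannian_metric g ->
  metric_components_on (chart_codom a) (g a \o param a).
Proof.
move=> [g_pos _ g_smooth]; split.
- exact: codom_open.
- by move=> u /chart_codomP/g_pos [].
- by move=> u /chart_codomP/g_pos [_ /posdef_unitmx].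
- by move=> u i j k Du; have [_ /(_ k) [+ _]] := g_smooth a i j 1; apply.
Qed.

End charts.

(** Lowering the index of the gradient gives back [df]. Positivity ensures that squaring undoes
    [Num.sqrt], which is zero on negative numbers. *)
Lemma gnorm_gradient_sqr (R : realType) n (G : 'rV[R]_n -> 'M[R]_n) f u :
  G u \in unitmx ->
  (forall v : 'rV[R]_n, v != 0 -> 0 < (v *m G u *m v^T) 0 0) ->
  Defs.gnorm G u (gradient G f u) ^+ 2 =
  \sum_k gradient G f u 0 k * pderive k f u.
Proof.
move=> uG G_gt0; rewrite /Defs.gnorm sqr_sqrtr; last first.
  have [->|/G_gt0/ltW//] := eqVneq (gradient G f u) 0.
  by rewrite !mul0mx mxE.
have gradE : (gradient G f u)^T = invmx (G u) *m \col_j pderive j f u.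
  by apply/matrixP => i j; rewrite !mxE; apply: eq_bigr => l _; rewrite mxE.
rewrite -mulmxA gradE mulKVmx// mxE.
by apply: eq_bigr => k _; rewrite [X in _ * X]mxE.
Qed.

Theorem proposition5p3 (R : realType) (m1 m2 : nat)
    (M1 : smoothManifold R m1) (M2 : smoothManifold R m2) (T : \bar R) (c : R)
    (g1 : R -> tensor2 M1) (lam : R -> M1 -> R) (g2 : tensor2 M2)
    (m2_ge2 : (2 <= m2)%N)
    (g1_metric : metric_family T g1)
    (lam_smooth : smooth_family T lam)
    (lam_gt0 : forall t x, time_interval T t -> 0 < lam t x)
    (g2_einstein : einstein_metric g2 c)
    (flow : hyperbolic_geometric_flow T
              (fun t => warped_metric (g1 t) (lam t) g2)) :
  forall (t : R) (a : chart M1) (x : M1), time_interval T t -> dom a x ->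
    (forall i j : 'I_m1,
       tderive2 T (fun s => g1 s a x i j) t =
         - 2 * Ric (g1 t) a x i j
         + 2 * m2%:R / lam t x * Hess (g1 t) (lam t) a x i j) /\
    tderive2 T (fun s => lam s x ^+ 2) t =
      - 2 * c + Laplacian (g1 t) (fun y => lam t y ^+ 2) a x
      + (2 * m2%:R - 4) * grad_norm (g1 t) (lam t) a x ^+ 2.
Proof.
move=> t a x It ax.
(* An auxiliary fiber point and chart, needed to read the flow equation at [(x, y)] in a product
   chart. *)
have [y _] := manifold_nonempty M2; have [b yb] := dom_cover y.
have xK : param a (Defs.coord a x) = x by rewrite coordK ?inE.
have yK : param b (Defs.coord b y) = y by rewrite coordK ?inE.
have Da : chart_codom a (Defs.coord a x) by exists x.
have Db : chart_codom b (Defs.coord b y) by exists y.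
pose u := row_mx (Defs.coord a x) (Defs.coord b y).
have lu : lsubmx u = Defs.coord a x by rewrite row_mxKl.
have ru : rsubmx u = Defs.coord b y by rewrite row_mxKr.
have Du : (lsubmx @^-1` chart_codom a `&` rsubmx @^-1` chart_codom b) u.
  by split; rewrite /= ?lu ?ru.
have [g1_riem _] := g1_metric; have [g2_riem g2_ric] := g2_einstein.
have g1_riem_t := g1_riem _ It.
have G1D := riemannian_metric_components a g1_riem_t.
have G2D := riemannian_metric_components b g2_riem.
pose phi := lam t \o param a.
have phi_neq0 v : chart_codom a v -> phi v != 0 by rewrite gt_eqF// lam_gt0.
have dphi v i : chart_codom a v -> derivable phi v (delta_mx 0 i).
  by move=> Dv; have [_ [_ /(_ i)[+ _]]] := lam_smooth a 1%N; exact.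
have d2phi v i j :
    chart_codom a v -> derivable (pderive i phi) v (delta_mx 0 j).
  move=> Dv; have [_ [_ /(_ i)[_ ]]] := lam_smooth a 2%N.
  by move=> [_ [_ /(_ j)[+ _]]]; exact.
have [[_ W_smooth] W_flow] := flow.
have xy_dom : @dom _ _ (prod_manifold M1 M2) (a, b) (x, y) by split.
have flow_xy i j := W_flow t (a, b) (x, y) i j It xy_dom.
have base i j := warped_ricci_base G1D G2D phi_neq0 dphi d2phi Du i j.
have fiber i j := warped_ricci_fiber G1D G2D phi_neq0 dphi d2phi Du i j.
split=> [i j|].
  rewrite (_ : (fun s => g1 s a x i j) = (fun s =>
      warped_metric (g1 s) (lam s) g2 (a, b) (x, y) (lshift m2 i) (lshift m2 j))).
    rewrite flow_xy [in LHS]mxE.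
    have := base i j; rewrite lu => baseij.
    rewrite [X in - 2 * X]baseij !mxE /phi /= xK.
    by ring.
  by apply/funext => s; rewrite block_mxEul.
(* The first fiber index. The diagonal entry of [g2] at [q] is positive, as the quadratic form on a
   basis vector, so it can be divided by. *)
pose q := Ordinal (ltnW m2_ge2).
have g2q_gt0 : 0 < g2 b y q q.
  have [g2_pos _ _] := g2_riem; have [_ /(_ (delta_mx 0 q))] := g2_pos b y yb.
  rewrite -rowE trmx_delta -colE !mxE; apply.
  apply/eqP => /rowP /(_ q) /eqP; rewrite !mxE !eqxx.
  by rewrite oner_eq0.
pose h s := warped_metric (g1 s) (lam s) g2 (a, b) (x, y) (rshift m1 q) (rshift m1 q).
have hE s : h s = lam s x ^+ 2 * g2 b y q q by rewrite /h block_mxEdr mxE.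
have Wu s : warped_metric (g1 s) (lam s) g2 (a, b)
    (@param _ _ (prod_manifold M1 M2) (a, b) u) (rshift m1 q) (rshift m1 q) = h s.
  by rewrite /= /prod_param /= lu ru xK yK.
have W_codom : @chart_codom _ _ (prod_manifold M1 M2) (a, b) u by exists (x, y).
(* Regularity in time comes from the smoothness of the flow metric: order 1 here, order 2 for [d2h].
   [Wu] identifies its component at [u] with [h]. *)
have dh s : time_interval T s -> tderivable T h s.
  move=> Is; have [_ [[+ _] _]] := W_smooth (a, b) (rshift m1 q) (rshift m1 q) 1%N.
  by move=> /(_ s u Is W_codom); under eq_fun do rewrite Wu.
have d2h : tderivable T (tderive T h) t.
  have [_ [[_ +] _]] := W_smooth (a, b) (rshift m1 q) (rshift m1 q) 2%N.
  move=> [_ [[+ _] _]] => /(_ t u It W_codom).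
  by under eq_fun do (under [X in tderive T X]eq_fun do rewrite Wu).
rewrite (_ : (fun s => _) = (fun s => (g2 b y q q)^-1 * h s)); last first.
  by apply/funext => s; rewrite hE mulrCA mulVf ?mulr1// gt_eqF.
rewrite tderive2Z// flow_xy [in LHS]mxE.
rewrite [X in - 2 * X](fiber q q) lu ru /Laplacian /grad_norm.
have /matrixP/(_ q q) := g2_ric _ _ yb; rewrite !mxE => ->.
(* The fiber Ricci formula supplies [2 * (m2 - 1)] copies of [|grad lam|^2]; the Laplacian of
   [lam ^+ 2] absorbs two of them, leaving [2 * m2 - 4]. *)
rewrite (laplacian_sqr (f := phi) G1D Da)//; last by move=> i k; exact: d2phi.
have [_ _ uG1 _] := G1D.
rewrite gnorm_gradient_sqr; [|exact: uG1|]; last first.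
  by rewrite /= xK; have [g1_pos _ _] := g1_riem_t; have [_] := g1_pos a x ax.
rewrite -/phi /= yK; field.
by rewrite gt_eqF.
Qed.
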